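(* Let $\Gamma_4^2,\Gamma_4^3,\Gamma_4^4$ be the coefficients, depending on $H\in(\tfrac12,1)$, of the projection $\mathbb{E}(\Delta_1\mid\Delta_2,\Delta_3,\Delta_4)=\Gamma_4^2\Delta_2+\Gamma_4^3\Delta_3+\Gamma_4^4\Delta_4$ for fractional Gaussian noise $(\Delta_k)$ with Hurst index $H$, as defined in the context. Then $$\lim_{H\uparrow1}\Gamma_4^2=\frac{531\log^2 4+72\log^2 6+51\log^2 9-384\log^2 12+108\log^2 18}{96\log^2 12-640\log^2 2-51\log^2 9}\approx 0.742250,$$ $$\lim_{H\uparrow1}\Gamma_4^3=\frac{48\log 2-15\log 9}{16\log 2-3\log 9}\approx 0.069508,$$ $$\lim_{H\uparrow1}\Gamma_4^4=\frac{108\log^2 18-364\log^2 2-216\log 2\,\log 9-81\log^2 9}{96\log^2 12-640\log^2 2-51\log^2 9}\approx 0.188242.$$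
   Context: Let $B^H=\{B^H_t,t\ge0\}$ be a fractional Brownian motion with Hurst index $H\in(\tfrac12,1)$, i.e. a centred Gaussian process with covariance $\tfrac12(t^{2H}+s^{2H}-|t-s|^{2H})$, and let $\Delta_n=B^H_n-B^H_{n-1}$, $n\ge 1$, be its increments (fractional Gaussian noise). They form a stationary Gaussian sequence with autocovariance $\rho_k=\mathbb{E}\Delta_1\Delta_{k+1}=\tfrac12(|k+1|^{2H}-2|k|^{2H}+|k-1|^{2H})$, $k\ge 0$ (so $\rho_0=1$). For $n\ge 2$ the real coefficients $\Gamma_n^k$, $2\le k\le n$, are defined by $\mathbb{E}(\Delta_1\mid\Delta_2,\dots,\Delta_n)=\sum_{k=2}^n\Gamma_n^k\Delta_k$; equivalently, they are the unique solution of the linear system $\rho_{l-1}=\sum_{k=2}^n\Gamma_n^k\rho_{|l-k|}$, $2\le l\le n$ (whose coefficient matrix is nonsingular). $\log$ is the natural logarithm and $\log^2 a=(\log a)^2$; the decimals are rounded values of the exact expressions. *)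

(* Defs.v *)
From HB Require Import structures.
From mathcomp Require Export all_boot all_order all_algebra.
From mathcomp Require Export all_classical all_reals all_analysis.

Set Implicit Arguments.
Unset Strict Implicit.
Unset Printing Implicit Defensive.

Import Order.TTheory GRing.Theory Num.Theory.
Export numFieldNormedType.Exports.

Local Open Scope classical_set_scope.
Local Open Scope ring_scope.

Section definitions.
Context {d : measure_display} {T : measurableType d} {R : realType}.
Variable P : probability T R.

(* [normal_prob m 0] is the uniform law on [0, 1], so the degenerate Gaussian
   law of variance 0 has to be given separately, as a Dirac mass. *)
Definition gaussian_rv (X : T -> R) : Prop :=
  exists m s : R, forall A : set R, measurable A ->
    pushforward P X A = if s == 0 then \d_m A else normal_prob m s A.

(* The time set is [0, +oo[: the values of [B] at negative times are junk, and
   no definition below looks at them. *)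
Definition gaussian_process (B : R -> {RV P >-> R}) : Prop :=
  forall (n : nat) (t a : 'I_n -> R), (forall i, 0 <= t i) ->
    gaussian_rv (fun w => \sum_(i < n) a i * B (t i) w).

Record fractional_brownian_motion (H : R) (B : R -> {RV P >-> R}) : Prop := {
  fbm_gaussian : gaussian_process B;
  fbm_centred : forall t, 0 <= t -> ('E_P[B t] = 0)%E;
  fbm_covariance : forall s t, 0 <= s -> 0 <= t ->
    covariance P (B s) (B t) =
      ((t `^ (2 * H) + s `^ (2 * H) - `|t - s| `^ (2 * H)) / 2)%:E }.

(* [Y] is a version of the conditional expectation of [X] given the
   sigma-algebra [G]; equality with a conditional expectation is almost sure
   equality, i.e., being such a version. *)
Record is_cond_exp (X : T -> R) (G : set (set T)) (Y : T -> R) : Prop := {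
  cond_exp_dom : P.-integrable setT (EFin \o X);
  cond_exp_integrable : P.-integrable setT (EFin \o Y);
  cond_exp_measurable : forall A : set R, measurable A -> G (Y @^-1` A);
  cond_exp_integral : forall A : set T, G A ->
    (\int[P]_(w in A) (Y w)%:E = \int[P]_(w in A) (X w)%:E)%E }.

(* Meaningful for 1 <= k. *)
Definition increment (B : R -> {RV P >-> R}) (k : nat) : T -> R :=
  fun w => B k%:R w - B k.-1%:R w.

Definition increments_sigma_algebra (B : R -> {RV P >-> R}) (n : nat) :
    set (set T) :=
  <<s \bigcup_(k in [set k | (2 <= k <= n)%N])
        preimage_set_system setT (increment B k) measurable >>.

(* E(Delta_1 | Delta_2, ..., Delta_n) = \sum_(2 <= k <= n) g k * Delta_k *)
Definition projection_coefficients (B : R -> {RV P >-> R}) (n : nat)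
    (g : nat -> R) : Prop :=
  is_cond_exp (increment B 1) (increments_sigma_algebra B n)
    (fun w => \sum_(2 <= k < n.+1) g k * increment B k w).

End definitions.

(* Rounding to the six-decimal number 0.abcdef, given by its two blocks of three
   digits abc and def: [nat] literals are unary, so [742250] is unusable. *)
Definition rounds_to {R : realType} (x : R) (abc def : nat) : Prop :=
  `|x - (abc%:R / 10 ^+ 3 + def%:R / 10 ^+ 6)| <= 10 ^- 6 / 2.

(* Main.v *)
Require Import Defs.
From mathcomp Require Import measurable_realfun ring lra.

(* The increments being square integrable, testing the conditional expectation
   against each of them gives the linear system with coefficients rho_|k-l|.
   By symmetry this 3 x 3 system splits into an equation for Gamma^2 - Gamma^4
   and a 2 x 2 system for Gamma^2 + Gamma^4 and Gamma^3. All the autocovariances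
   tend to 1 as H tends to 1, so that numerators and denominators vanish to first
   order in 1 - H, and the limits are read off the derivatives of the rho_k
   at H = 1. For the decimals, ln 2 and ln 3 are obtained from ln (3 / 2) and
   ln (4 / 3), which the series of artanh at 1 / 5 and 1 / 7 approximates well. *)

Set Implicit Arguments.
Unset Strict Implicit.
Unset Printing Implicit Defensive.

Import Order.TTheory GRing.Theory Num.Theory.
Local Open Scope classical_set_scope.
Local Open Scope ring_scope.

(** * Testing a conditional expectation against an increment *)

Section orthogonality.
Context {d : measure_display} {T : measurableType d} {R : realType}.
Variable P : {measure set T -> \bar R}.
Import HBNNSimple.

(** A simple [h] has finite range, so [h (Z w)] is a finite combination of indicators of preimages
    under [Z], and [W] integrates to 0 over each of them. *)
Lemma integral_mul_sfun_comp_eq0 (W Z : T -> R) (h : {nnsfun R >-> R}) :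
    measurable_fun setT Z -> P.-integrable setT (EFin \o W) ->
    (forall A, measurable A -> \int[P]_(w in Z @^-1` A) (W w)%:E = 0)%E ->
  (\int[P]_w (W w * h (Z w))%:E = 0)%E.
Proof.
move=> mZ iW W0.
pose s : seq R := finmap.enum_fset (fset_set (range h)).
pose G y w := ((W w)%:E * (\1_(Z @^-1` (h @^-1` [set y])) w)%:E)%E.
have mA y : measurable (Z @^-1` (h @^-1` [set y])).
  by rewrite -[X in measurable X]setTI; apply: mZ => //; exact: measurable_funPTI.
have GE y : G y = (EFin \o W) \_ (Z @^-1` (h @^-1` [set y])).
  apply/funext => w; rewrite /G /= patchE indicE.
  by case: ifPn => _; rewrite ?mule1 ?mule0.
have iG y : P.-integrable setT (G y).
  by rewrite GE -integrable_mkcond//; exact: integrableS iW.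
transitivity (\int[P]_w (\sum_(y <- s) y%:E * G y w))%E.
  apply: eq_integral => w _.
  rewrite (fimfunE h) fsbig_finite//= mulr_sumr -sumEFin.
  by apply: eq_bigr => y _; rewrite -!EFinM mulrCA.
rewrite integral_sum//; last by move=> y; exact: integrableZl.
apply: big1_seq => y _; rewrite integralZl// GE -integral_mkcond W0 ?mule0//.
Qed.

(** Dominated convergence along simple functions increasing to [u], with the absolute value of
    [W * u (Z)] as the bound. Keeping [u] separate from [Z] lets both the positive and the negative
    part of [Z] be treated with the same family of events. *)
Lemma integral_mul_ge0_comp_eq0 (W Z : T -> R) (u : R -> R) :
    measurable_fun setT Z -> measurable_fun setT u -> (forall x, 0 <= u x) ->
    P.-integrable setT (EFin \o W) ->
    P.-integrable setT (fun w => (W w * u (Z w))%:E) ->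
    (forall A, measurable A -> \int[P]_(w in Z @^-1` A) (W w)%:E = 0)%E ->
  (\int[P]_w (W w * u (Z w))%:E = 0)%E.
Proof.
move=> mZ mu u0 iW iWu W0.
have mW : measurable_fun setT W.
  by apply/measurable_EFinP; exact: measurable_int iW.
have meu : measurable_fun setT (EFin \o u) by exact/measurable_EFinP.
pose h := nnsfun_approx measurableT meu.
have hu x : EFin (h n x) @[n --> \oo] --> (u x)%:E.
  apply: (@cvg_nnsfun_approx _ _ _ setT measurableT (EFin \o u)) => // y _.
  by rewrite lee_fin.
have h_le n x : h n x <= u x.
  rewrite -lee_fin /h nnsfun_approxE; apply: le_approx => // y _.
  by rewrite /= lee_fin.
have [|||||_ _] := @dominated_convergence _ T R P setT measurableT
    (fun n w => (W w * h n (Z w))%:E) (fun w => (W w * u (Z w))%:E)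
    (abse \o (fun w => (W w * u (Z w))%:E)).
- move=> n; apply/measurable_EFinP; apply: measurable_funM => //.
  exact: measurableT_comp.
- apply/measurable_EFinP; apply: measurable_funM => //.
  exact: measurableT_comp.
- apply: aeW => w _; under eq_fun do rewrite EFinM; rewrite EFinM.
  by apply: cvgeZl.
- exact: integrable_abse.
- apply: aeW => w n _ /=; rewrite lee_fin !normrM ler_wpM2l//.
  by rewrite !ger0_norm.
under eq_fun do rewrite integral_mul_sfun_comp_eq0//.
by move/cvg_lim => <- //; rewrite lim_cst.
Qed.

(** Splits [Z] into positive and negative parts; both products with [W] are dominated by [W * Z],
    hence integrable. *)
Lemma integral_mul_eq0 (W Z : T -> R) :
    measurable_fun setT Z ->
    P.-integrable setT (EFin \o W) ->
    P.-integrable setT (fun w => (W w * Z w)%:E) ->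
    (forall A, measurable A -> \int[P]_(w in Z @^-1` A) (W w)%:E = 0)%E ->
  (\int[P]_w (W w * Z w)%:E = 0)%E.
Proof.
move=> mZ iW iWZ W0.
have mW : measurable_fun setT W.
  by apply/measurable_EFinP; exact: measurable_int iW.
pose up (x : R) := Num.max x 0; pose un (x : R) := Num.max (- x) 0.
have mup : measurable_fun setT up by exact: measurable_maxr.
have mun : measurable_fun setT un.
  by apply: measurable_maxr => //; exact: measurable_funN.
have dom (u : R -> R) : measurable_fun setT u -> (forall x, `|u x| <= `|x|) ->
    P.-integrable setT (fun w => (W w * u (Z w))%:E).
  move=> mu ux; apply: le_integrable iWZ => //.
    apply/measurable_EFinP; apply: measurable_funM => //.
    exact: measurableT_comp.
  by move=> w _; rewrite /= lee_fin !normrM ler_wpM2l.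
have iup : P.-integrable setT (fun w => (W w * up (Z w))%:E).
  apply: dom => // x; rewrite /up; case: (leP x 0) => x0; last by [].
  by rewrite normr0.
have iun : P.-integrable setT (fun w => (W w * un (Z w))%:E).
  apply: dom => // x; rewrite /un; case: (leP (- x) 0) => x0.
    by rewrite normr0.
  by rewrite normrN.
rewrite (eq_integral
  (fun w => (W w * up (Z w))%:E - (W w * un (Z w))%:E))%E; last first.
  move=> w _; rewrite -EFinB -mulrBr; congr (_ * _)%:E.
  by rewrite /up /un; case: (leP (Z w) 0); case: (leP (- Z w) 0) => *; lra.
rewrite integralB// !integral_mul_ge0_comp_eq0 ?sube0//.
  by move=> x; rewrite /un le_max lexx orbT.
by move=> x; rewrite /up le_max lexx orbT.
Qed.

End orthogonality.

(** * Conditional expectation as an orthogonal projection *)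

Section projection.
Context {d : measure_display} {T : measurableType d} {R : realType}.
Variable P : probability T R.

Lemma Lfun2_sqr_lty (X : T -> R) : measurable_fun setT X ->
  ('E_P[X * X] < +oo)%E -> X \in Lfun P 2%:E.
Proof.
move=> mX; rewrite unlock => X2; rewrite inE; apply/andP; split; rewrite inE//=.
rewrite /finite_norm unlock poweR_lty//.
apply: le_lt_trans X2; rewrite le_eqVlt; apply/orP; left; apply/eqP.
apply: eq_integral => w _ /=.
by rewrite powR_mulrn// -normrX ger0_norm ?sqr_ge0// expr2.
Qed.

Lemma Lfun_measurable (X : T -> R) p : X \in Lfun P p -> measurable_fun setT X.
Proof. by rewrite inE => /andP[+ _]; rewrite inE. Qed.

(** The error [X - Y] integrates to 0 over every preimage under [Z], since these belong to [G];
    hence it is orthogonal to [Z]. *)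
Lemma is_cond_exp_expectationM (X Y Z : T -> R) (G : set (set T)) :
    is_cond_exp P X G Y -> (forall A, measurable A -> G (Z @^-1` A)) ->
    X \in Lfun P 2%:E -> Y \in Lfun P 2%:E -> Z \in Lfun P 2%:E ->
  'E_P[X * Z]%E = 'E_P[Y * Z]%E.
Proof.
move=> [iX iY _ XY] GZ X2 Y2 Z2; have mZ := Lfun_measurable Z2.
have iXZ : (X * Z) \in Lfun P 1 by exact: Lfun2_mul_Lfun1.
have iYZ : (Y * Z) \in Lfun P 1 by exact: Lfun2_mul_Lfun1.
have -> : X * Z = Y * Z + (X * Z - Y * Z) by rewrite addrC subrK.
rewrite [LHS]expectationD ?rpredB// -[RHS]adde0; congr (_ + _)%E; rewrite unlock.
transitivity (\int[P]_w ((X \- Y) w * Z w)%:E)%E.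
  by apply: eq_integral => w _ /=; rewrite mulrBl.
apply: integral_mul_eq0 => //.
- by rewrite (_ : _ \o _ = (EFin \o X) \- (EFin \o Y))%E//; exact: integrableB.
- apply/Lfun1_integrable; rewrite (_ : (fun w => _) = X * Z - Y * Z)//.
    by rewrite rpredB.
  by apply/funext => w /=; rewrite mulrBl.
- move=> A mA.
  have mZA : measurable (Z @^-1` A).
    by rewrite -[X in measurable X]setTI; exact: mZ.
  rewrite integralB_EFin//; [|exact: integrableS iX|exact: integrableS iY].
  rewrite (XY _ (GZ _ mA)) subee//; apply: integrable_fin_num => //.
  exact: integrableS iX.
Qed.

End projection.

(** * Second moments of the increments and the normal equations *)

Section fbm.
Context {d : measure_display} {T : measurableType d} {R : realType}.
Variables (P : probability T R) (H : R) (B : R -> {RV P >-> R}).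
Hypothesis fbmB : fractional_brownian_motion H B.

Lemma fbm_expectationM s t : 0 <= s -> 0 <= t ->
  'E_P[B s * B t]%E =
  ((t `^ (2 * H) + s `^ (2 * H) - `|t - s| `^ (2 * H)) / 2)%:E.
Proof.
move=> s0 t0; rewrite -(fbm_covariance fbmB)// covariance.unlock.
rewrite !(fbm_centred fbmB)//; congr ('E_P[_])%E.
by apply/funext => w; rewrite !fctE /= !subr0.
Qed.

Lemma fbm_Lfun2 t : 0 <= t -> (B t : T -> R) \in Lfun P 2%:E.
Proof.
by move=> t0; apply: Lfun2_sqr_lty => //; rewrite fbm_expectationM// ltry.
Qed.

Lemma increment_Lfun2 k : increment B k \in Lfun P 2%:E.
Proof.
rewrite (_ : increment B k = (B k%:R : T -> R) - (B k.-1%:R : T -> R))//.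
by rewrite rpredB ?lee1n// => *; exact: fbm_Lfun2.
Qed.

(** By bilinearity the terms in a single time cancel, leaving a second difference of the power
    function. The successors avoid the truncated predecessor in [increment]. *)
Lemma increment_expectationM i j :
  'E_P[increment B i.+1 * increment B j.+1]%E =
  ((`|j%:R - i%:R + 1| `^ (2 * H) - 2 * `|j%:R - i%:R| `^ (2 * H)
     + `|j%:R - i%:R - 1| `^ (2 * H)) / 2)%:E.
Proof.
pose b k : T -> R := B k%:R.
have b2 k : b k \in Lfun P 2%:E by exact: fbm_Lfun2.
have bb k l : b k * b l \in Lfun P 1 by exact: Lfun2_mul_Lfun1.
rewrite (_ : _ * _ =
  (b i.+1 * b j.+1 - b i.+1 * b j) - (b i * b j.+1 - b i * b j)).
  rewrite [LHS]expectationB ?rpredB// expectationB// expectationB//.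
  rewrite !fbm_expectationM// -!EFinB; congr EFin.
  rewrite -!(natr1 i) -!(natr1 j).
  have -> : j%:R + 1 - (i%:R + 1) = j%:R - i%:R :> R by ring.
  have -> : j%:R - (i%:R + 1) = j%:R - i%:R - 1 :> R by ring.
  have -> : j%:R + 1 - i%:R = j%:R - i%:R + 1 :> R by ring.
  lra.
by apply/funext => w; rewrite /increment /b !fctE /=; ring.
Qed.

(** Multiplies the projection by the increment of index [l] and takes expectations, using linearity
    of the integral. *)
Lemma projection_normal_equation n g l : (2 <= l <= n)%N ->
    projection_coefficients B n g ->
  ('E_P[increment B 1 * increment B l] =
   \sum_(2 <= k < n.+1) (g k)%:E * 'E_P[increment B k * increment B l])%E.
Proof.
move=> ln gE.
have i2 := increment_Lfun2.
have ii k : increment B k * increment B l \in Lfun P 1 by exact: Lfun2_mul_Lfun1.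
set Y := fun w => \sum_(2 <= k < n.+1) g k * increment B k w.
have Y2 : Y \in Lfun P 2%:E.
  rewrite (_ : Y = \sum_(2 <= k < n.+1) (g k \o* increment B k)).
    by rewrite rpred_sum ?lee1n// => p1 k _; rewrite Lfun_scale// ler1n.
  by apply/funext => w; rewrite fct_sumE; apply: eq_bigr => k _ /=; rewrite mulrC.
rewrite (is_cond_exp_expectationM gE)//; last first.
  (* Since [2 <= l <= n], preimages under the increment of index [l] are among the generators of the
     sigma-algebra. *)
  move=> A mA; apply: sub_sigma_algebra; exists l => //.
  by exists A => //; rewrite setTI.
rewrite unlock.
pose F k w := ((g k)%:E * (increment B k w * increment B l w)%:E)%E.
have iF k : P.-integrable setT (fun w => (increment B k w * increment B l w)%:E).
  by have /Lfun1_integrable := ii k.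
transitivity (\int[P]_w (\sum_(2 <= k < n.+1) F k w))%E.
  apply: eq_integral => w _; rewrite /F /Y fctE mulr_suml -sumEFin.
  by apply: eq_bigr => k _; rewrite -mulrA EFinM.
rewrite integral_sum//; last by move=> k; exact: integrableZl.
by apply: eq_bigr => k _; rewrite integralZl.
Qed.

End fbm.

(** * Limits and bounds of logarithms *)

Section limits.
Context {R : realType}.

(** By Carathéodory's criterion the difference quotient agrees, off [a], with a function continuous
    at [a] whose value there is the derivative. *)
Lemma is_derive_cvg_at_left (f : R -> R) (a df : R) : is_derive a 1 f df ->
  (f a - f x) / (a - x) @[x --> a^'-] --> df.
Proof.
move=> /is_derive1_caratheodory[g [fE cg <-]].
apply: (@cvg_trans _ (g x @[x --> a^'-])); last exact: cvg_at_left_filter.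
apply: near_eq_cvg; near=> x.
have xa : a - x != 0 by rewrite subr_eq0 gt_eqF//; near: x; exact: nbhs_left_lt.
by rewrite -opprB fE -mulrN opprB mulfK.
Unshelve. all: by end_near. Qed.

Lemma cvg_powR_slope (k : R) : 0 < k ->
  (k ^+ 2 - k `^ (2 * x)) / (1 - x) @[x --> 1^'-] --> 2 * k ^+ 2 * ln k.
Proof.
move=> k0.
have := @is_derive_cvg_at_left (fun x => k `^ (2 * x)) 1 (2 * k ^+ 2 * ln k).
rewrite mulr1 powR_mulrn ?ltW//; apply.
(* As [k] is nonzero, the power is the exponential of a linear function of the exponent. *)
rewrite (_ : (fun x => _) = expR \o (fun x => (2 * ln k) * x)); last first.
  by apply/funext => x; rewrite /powR gt_eqF//= mulrAC.
apply: is_derive_eq.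
rewrite [_%:A]mulr1 mulr1 expRM_natl lnK ?posrE//.
by rewrite mulrCA mulrA.
Qed.

End limits.

(* The sum and difference of the first and third equations separate [g2 - g4]
   from [g2 + g4] and [g3]; every term then carries a factor [e], which
   cancels. *)
Lemma fgn_projection_solution (R : numFieldType) (e A B C g2 g3 g4 : R) :
  e != 0 -> B != 0 -> 4 * A - B - 2 * e * A ^+ 2 != 0 ->
  let r1 := 1 - e * A in let r2 := 1 - e * B in let r3 := 1 - e * C in
  r1 = g2 + g3 * r1 + g4 * r2 ->
  r2 = g2 * r1 + g3 + g4 * r1 ->
  r3 = g2 * r2 + g3 * r1 + g4 ->
  let s := (A - C + 2 * B - 2 * e * A * B) / (4 * A - B - 2 * e * A ^+ 2) in
  let d := (C - A) / B in
  [/\ g2 = (s + d) / 2,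
      g3 = (3 * A + C - 3 * B + e * (B ^+ 2 - A ^+ 2 - A * C))
           / (4 * A - B - 2 * e * A ^+ 2) &
      g4 = (s - d) / 2].
Proof.
move=> e0 B0 D0 r1 r2 r3 E1 E2 E3 s d.
have {}E1 : r1 - (g2 + g3 * r1 + g4 * r2) = 0 by rewrite -E1 subrr.
have {}E2 : r2 - (g2 * r1 + g3 + g4 * r1) = 0 by rewrite -E2 subrr.
have {}E3 : r3 - (g2 * r2 + g3 * r1 + g4) = 0 by rewrite -E3 subrr.
(* Each unknown is found from a combination of the equations that eliminates the others and is
   divisible by [e]. *)
have solve (D N x : R) : D != 0 -> e * (N - x * D) = 0 -> x = N / D.
  move=> {}D0 /eqP; rewrite mulf_eq0 (negbTE e0)/= subr_eq0 => /eqP ->.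
  by rewrite mulfK.
have sE : g2 + g4 = s.
  apply: solve => //.
  (* Adding the first and third equations and subtracting [2 * r1] times the second eliminates [g3];
     the coefficient left on [g2 + g4] is [1 + r2 - 2 * r1 ^+ 2], which is [e] times the denominator
     of [s]. *)
  transitivity ((r1 - (g2 + g3 * r1 + g4 * r2)) + (r3 - (g2 * r2 + g3 * r1 + g4))
     - 2 * r1 * (r2 - (g2 * r1 + g3 + g4 * r1))); last by rewrite E1 E2 E3; ring.
  by rewrite /r1 /r2 /r3; ring.
have dE : g2 - g4 = d.
  apply: solve => //.
  transitivity ((r1 - (g2 + g3 * r1 + g4 * r2))
    - (r3 - (g2 * r2 + g3 * r1 + g4))).
    by rewrite /r1 /r2 /r3; ring.
  by rewrite E1 E3; ring.
rewrite -sE -dE; split; [by field| |by field].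
apply: solve => //.
(* The multipliers [1 + r2] and [r1] eliminate [g2 + g4] and leave the same determinant on [g3]. *)
transitivity ((1 + r2) * (r2 - (g2 * r1 + g3 + g4 * r1))
   - r1 * ((r1 - (g2 + g3 * r1 + g4 * r2)) + (r3 - (g2 * r2 + g3 * r1 + g4)))).
  by rewrite /r1 /r2 /r3; ring.
by rewrite E1 E2 E3; ring.
Qed.

(** * Two-sided bounds for logarithms from the artanh series *)

Section ln_bounds.
Context {R : realType}.

Lemma is_derive_ln_ratio (x : R) : `|x| < 1 ->
  is_derive x 1 (fun t => ln (1 + t) - ln (1 - t)) (2 / (1 - x ^+ 2)).
Proof.
rewrite ltr_norml => /andP[x0 x1].
have p0 : 0 < 1 + x by lra.
have m0 : 0 < 1 - x by lra.
have d1 : is_derive x 1 (fun t : R => ln (1 + t)) (1 + x)^-1.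
  have dp : is_derive x 1 (cst 1 + (id : R -> R)) 1.
    by apply: is_derive_eq; rewrite add0r.
  have := @is_derive1_comp R (@ln R) (fun t => 1 + t) _ _ _ (is_derive1_ln p0) dp.
  by rewrite mulr1.
have d2 : is_derive x 1 (fun t : R => ln (1 - t)) (- (1 - x)^-1).
  have dm : is_derive x 1 (cst 1 - (id : R -> R)) (-1).
    by apply: is_derive_eq; rewrite add0r.
  have := @is_derive1_comp R (@ln R) (fun t => 1 - t) _ _ _ (is_derive1_ln m0) dm.
  by rewrite mulrN1.
apply: is_derive_eq.
have e : 1 - x ^+ 2 != 0 by rewrite gt_eqF//; nra.
by field; rewrite e !gt_eqF.
Qed.

(** The first [n] nonzero terms of the Taylor series at 0 of artanh, which is half of
    [ln ((1 + x) / (1 - x))]. *)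
Definition artanh_sum (n : nat) (x : R) : R :=
  \sum_(k < n) x ^+ k.*2.+1 / k.*2.+1%:R.

(** Termwise differentiation gives a geometric sum of ratio [x ^+ 2]. *)
Lemma is_derive_artanh_sum n (x : R) : x ^+ 2 != 1 ->
  is_derive x 1 (artanh_sum n) ((1 - x ^+ n.*2) / (1 - x ^+ 2)).
Proof.
move=> x1.
have dk k : is_derive x 1 (k.*2.+1%:R^-1 *: (id : R -> R) ^+ k.*2.+1) (x ^+ k.*2).
  apply: is_derive_eq; rewrite /GRing.scale/= mulr1 -mulr_natl.
  by rewrite mulKf// pnatr_eq0.
have -> : artanh_sum n = \sum_(k < n) (k.*2.+1%:R^-1 *: (id : R -> R) ^+ k.*2.+1).
  apply/funext => t; rewrite fct_sumE; apply: eq_bigr => k _.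
  by rewrite !fctE [RHS]mulrC.
apply: is_derive_eq.
have x2 : 1 - x ^+ 2 != 0 by rewrite subr_eq0 eq_sym.
apply: (mulIf x2); rewrite divfK// mulrC -mul2n exprM.
rewrite -[RHS]opprB subrX1 -[RHS]mulNr opprB; congr (_ * _).
apply: eq_bigr => k _.
by rewrite -exprM mul2n.
Qed.

Lemma derive_ge0_le (f df : R -> R) (a b : R) : a <= b ->
    (forall t, a <= t <= b -> is_derive t 1 f (df t)) ->
    (forall t, a <= t <= b -> 0 <= df t) ->
  f a <= f b.
Proof.
move=> ab fdf df0; rewrite -subr_ge0.
have [||c + ->] := @MVT_segment R f df a b ab.
- move=> t; rewrite in_itv/= => /andP[/ltW at_ /ltW tb].
  by apply: fdf; rewrite at_.
- apply: derivable_within_continuous => t; rewrite in_itv/= => tab.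
  by have [] := fdf t tab.
- by rewrite in_itv/= => cab; rewrite mulr_ge0 ?subr_ge0// df0.
Qed.

(** The remainder vanishes at 0 and has derivative [2 * t ^+ n.*2 / (1 - t ^+ 2)], which on [[0, x]]
    is nonnegative and at most [2 * t ^+ n.*2 / (1 - x ^+ 2)]. Integrating these two bounds gives
    the estimate. *)
Lemma ln_ratio_bounds n (x : R) : 0 <= x < 1 ->
  2 * artanh_sum n x <= ln ((1 + x) / (1 - x)) <=
  2 * (artanh_sum n x + x ^+ n.*2.+1 / (n.*2.+1%:R * (1 - x ^+ 2))).
Proof.
move=> /andP[x0 x1].
pose F (t : R) := ln (1 + t) - ln (1 - t).
have x2 : 0 < 1 - x ^+ 2 by nra.
have S0 : artanh_sum n 0 = 0.
  by rewrite /artanh_sum big1// => k _; rewrite expr0n mul0r.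
have F0 : F 0 = 0 by rewrite /F addr0 subr0 subrr.
have t1 (t : R) : 0 <= t <= x -> [/\ `|t| < 1, 0 < 1 - t ^+ 2,
    1 - x ^+ 2 <= 1 - t ^+ 2 & 0 <= t ^+ n.*2].
  move=> /andP[t0 tx]; rewrite ger0_norm// exprn_ge0//; split => //; nra.
have t2 (t : R) : 0 < 1 - t ^+ 2 -> t ^+ 2 != 1.
  by move=> h; rewrite lt_eqF//; lra.
have FE : ln ((1 + x) / (1 - x)) = F x.
  by rewrite ln_div ?posrE//; lra.
rewrite FE; apply/andP; split.
- rewrite -subr_ge0.
  have := @derive_ge0_le (fun t => F t - 2 * artanh_sum n t)
    (fun t => 2 * t ^+ n.*2 / (1 - t ^+ 2)) 0 x x0.
  rewrite F0 S0 mulr0 subr0; apply.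
    move=> t /t1 [tn tp tm tX].
    have d1 : is_derive t 1 F (2 / (1 - t ^+ 2)) by exact: is_derive_ln_ratio.
    have d2 := @is_derive_artanh_sum n _ (t2 _ tp).
    rewrite (_ : (fun t => _) = F - 2 *: artanh_sum n)//; apply: is_derive_eq.
    by rewrite /GRing.scale/=; field; rewrite gt_eqF.
  move=> t /t1 [tn tp tm tX].
  by rewrite divr_ge0 ?mulr_ge0// ltW.
- rewrite -subr_ge0.
  (* Chosen so that [c * t ^+ n.*2.+1] has derivative [2 * t ^+ n.*2 / (1 - x ^+ 2)]. *)
  pose c := 2 / (n.*2.+1%:R * (1 - x ^+ 2)).
  have := @derive_ge0_le (fun t => 2 * artanh_sum n t + c * t ^+ n.*2.+1 - F t)
    (fun t => 2 * t ^+ n.*2 / (1 - x ^+ 2) - 2 * t ^+ n.*2 / (1 - t ^+ 2)) 0 x x0.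
  rewrite F0 S0 expr0n /= !mulr0 !subr0 addr0 => H.
  rewrite (_ : 2 * (_ + _) = 2 * artanh_sum n x + c * x ^+ n.*2.+1); last first.
    by rewrite /c; field; rewrite !gt_eqF// ltr0n.
  apply: H.
    move=> t /t1 [tn tp tm tX].
    have d1 : is_derive t 1 F (2 / (1 - t ^+ 2)) by exact: is_derive_ln_ratio.
    have d2 := @is_derive_artanh_sum n _ (t2 _ tp).
    rewrite (_ : (fun t => _) =
      2 *: artanh_sum n + c *: (id : R -> R) ^+ n.*2.+1 - F); last first.
      by apply/funext => y; rewrite !fctE.
    apply: is_derive_eq.
    rewrite /GRing.scale/= /c; field.
    by rewrite !gt_eqF// ltr0n.
  move=> t /t1 [tn tp tm tX].
  by rewrite subr_ge0 ler_wpM2l ?mulr_ge0// lef_pV2.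
Qed.

End ln_bounds.

(** * Decimal values and closed forms of the limits *)

Section ln_numerics.
Context {R : realType}.

Lemma ln_3div2_bounds :
  405 / 10 ^+ 3 + 465 / 10 ^+ 6 + 100 / 10 ^+ 9 <= ln (3 / 2 : R)
  <= 405 / 10 ^+ 3 + 465 / 10 ^+ 6 + 120 / 10 ^+ 9.
Proof.
(* With five terms at 1/5 the two bounds differ by less than 4e-9, well within the stated interval
   of width 2e-8. *)
have := @ln_ratio_bounds R 5 (1 / 5).
rewrite (_ : (1 + _) / _ = 3 / 2); last by field.
rewrite /artanh_sum !big_ord_recr big_ord0 /= !doubleS double0 => H.
have {H} /andP[lo hi] := H ltac:(lra).
apply/andP; split; first lra.
by rewrite (_ : 1 - _ ^+ 2 = 24 / 25) in hi; [lra|field].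
Qed.

Lemma ln_4div3_bounds :
  287 / 10 ^+ 3 + 682 / 10 ^+ 6 + 70 / 10 ^+ 9 <= ln (4 / 3 : R)
  <= 287 / 10 ^+ 3 + 682 / 10 ^+ 6 + 75 / 10 ^+ 9.
Proof.
have := @ln_ratio_bounds R 5 (1 / 7).
rewrite (_ : (1 + _) / _ = 4 / 3); last by field.
rewrite /artanh_sum !big_ord_recr big_ord0 /= !doubleS double0 => H.
have {H} /andP[lo hi] := H ltac:(lra).
apply/andP; split; first lra.
by rewrite (_ : 1 - _ ^+ 2 = 48 / 49) in hi; [lra|field].
Qed.

Lemma ln2_split : ln 2 = ln (3 / 2) + ln (4 / 3) :> R.
Proof. by rewrite -lnM ?posrE//; congr ln; field. Qed.

Lemma ln3_split : ln 3 = 2 * ln (3 / 2) + ln (4 / 3) :> R.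
Proof.
rewrite mulr_natl mulr2n -!lnM ?posrE//; try lra.
by congr ln; field.
Qed.

(* The limits of [(1 - rho_k) / (1 - H)] at [H = 1] for [k = 1, 2, 3], then those
   of Gamma^2 + Gamma^4, Gamma^2 - Gamma^4 and Gamma^3. *)
Definition slope1 : R := 4 * ln 2.
Definition slope2 : R := 9 * ln 3 - 8 * ln 2.
Definition slope3 : R := 36 * ln 2 - 18 * ln 3.

Definition lim_sum : R :=
  (slope1 - slope3 + 2 * slope2) / (4 * slope1 - slope2).
Definition lim_diff : R := (slope3 - slope1) / slope2.
Definition lim_mid : R :=
  (3 * slope1 + slope3 - 3 * slope2) / (4 * slope1 - slope2).

Lemma slope2_gt0 : 0 < slope2.
Proof.
have := ln_3div2_bounds; have := ln_4div3_bounds.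
rewrite /slope2 ln2_split ln3_split; lra.
Qed.

Lemma slope12_gt0 : 0 < 4 * slope1 - slope2.
Proof.
have := ln_3div2_bounds; have := ln_4div3_bounds.
rewrite /slope2 /slope1 ln2_split ln3_split; lra.
Qed.

(** Clearing the positive denominator leaves inequalities linear in [ln (3 / 2)] and
    [ln (4 / 3)]. *)
Lemma lim_sum_bounds :
  930 / 10 ^+ 3 + 491 / 10 ^+ 6 + 570 / 10 ^+ 9 <= lim_sum
  <= 930 / 10 ^+ 3 + 491 / 10 ^+ 6 + 690 / 10 ^+ 9.
Proof.
have := ln_3div2_bounds; have := ln_4div3_bounds; have := slope12_gt0.
rewrite /lim_sum => h; rewrite ler_pdivlMr// ler_pdivrMr//.
rewrite /slope3 /slope2 /slope1 ln2_split ln3_split; lra.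
Qed.

Lemma lim_diff_bounds :
  554 / 10 ^+ 3 + 8 / 10 ^+ 6 + 230 / 10 ^+ 9 <= lim_diff
  <= 554 / 10 ^+ 3 + 8 / 10 ^+ 6 + 360 / 10 ^+ 9.
Proof.
have := ln_3div2_bounds; have := ln_4div3_bounds; have := slope2_gt0.
rewrite /lim_diff => h; rewrite ler_pdivlMr// ler_pdivrMr//.
rewrite /slope3 /slope2 /slope1 ln2_split ln3_split; lra.
Qed.

Lemma lim_mid_rounds : rounds_to lim_mid 069 508.
Proof.
have := ln_3div2_bounds; have := ln_4div3_bounds; have := slope12_gt0.
rewrite /rounds_to ler_distl /lim_mid => h.
rewrite ler_pdivlMr// ler_pdivrMr//.
rewrite /slope3 /slope2 /slope1 ln2_split ln3_split; lra.
Qed.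

Lemma lim_half_sum_rounds : rounds_to ((lim_sum + lim_diff) / 2) 742 250.
Proof.
have := lim_sum_bounds; have := lim_diff_bounds.
rewrite /rounds_to ler_distl; lra.
Qed.

(** This value lies within 3e-7 of the rounding boundary 0.1882415, so the bounds on [lim_sum] and
    [lim_diff] need more than six decimals. *)
Lemma lim_half_diff_rounds : rounds_to ((lim_sum - lim_diff) / 2) 188 242.
Proof.
have := lim_sum_bounds; have := lim_diff_bounds.
rewrite /rounds_to ler_distl; lra.
Qed.

Lemma ln_4_6_9_12_18 :
  [/\ ln 4 = 2 * ln 2 :> R, ln 6 = ln 2 + ln 3 :> R, ln 9 = 2 * ln 3 :> R,
      ln 12 = 2 * ln 2 + ln 3 :> R & ln 18 = ln 2 + 2 * ln 3 :> R].
Proof.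
by split; rewrite ?mulr_natl ?mulr2n -!lnM ?posrE//; congr ln; ring.
Qed.

(** The common denominator of the first and third limits is, up to the factor 4/3, the product of
    the denominators of [lim_diff] and [lim_sum]; in particular it is nonzero. *)
Let denE : 96 * ln 12 ^+ 2 - 640 * ln 2 ^+ 2 - 51 * ln 9 ^+ 2 =
  4 / 3 * slope2 * (4 * slope1 - slope2) :> R.
Proof.
have [_ _ -> -> _] := ln_4_6_9_12_18.
by rewrite /slope1 /slope2; field.
Qed.

Lemma lim_half_sumE : (lim_sum + lim_diff) / 2 =
  (531 * ln 4 ^+ 2 + 72 * ln 6 ^+ 2 + 51 * ln 9 ^+ 2 - 384 * ln 12 ^+ 2
     + 108 * ln 18 ^+ 2)
  / (96 * ln 12 ^+ 2 - 640 * ln 2 ^+ 2 - 51 * ln 9 ^+ 2).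
Proof.
have n2 := lt0r_neq0 slope2_gt0; have n1 := lt0r_neq0 slope12_gt0.
rewrite denE; have [-> -> -> -> ->] := ln_4_6_9_12_18.
rewrite /lim_sum /lim_diff.
move: n1 n2; rewrite /slope3 /slope2 /slope1 => n1 n2.
by field; rewrite n1 n2.
Qed.

Lemma lim_half_diffE : (lim_sum - lim_diff) / 2 =
  (108 * ln 18 ^+ 2 - 364 * ln 2 ^+ 2 - 216 * ln 2 * ln 9 - 81 * ln 9 ^+ 2)
  / (96 * ln 12 ^+ 2 - 640 * ln 2 ^+ 2 - 51 * ln 9 ^+ 2).
Proof.
have n2 := lt0r_neq0 slope2_gt0; have n1 := lt0r_neq0 slope12_gt0.
rewrite denE; have [_ _ -> _ ->] := ln_4_6_9_12_18.
rewrite /lim_sum /lim_diff.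
move: n1 n2; rewrite /slope3 /slope2 /slope1 => n1 n2.
by field; rewrite n1 n2.
Qed.

Lemma lim_midE : lim_mid = (48 * ln 2 - 15 * ln 9) / (16 * ln 2 - 3 * ln 9).
Proof.
have n1 := lt0r_neq0 slope12_gt0; have [_ _ -> _ _] := ln_4_6_9_12_18.
rewrite /lim_mid; move: n1; rewrite /slope3 /slope2 /slope1 => n1.
(* This is two thirds of [4 * slope1 - slope2]. *)
have n2 : 16 * ln 2 - 3 * (2 * ln 3) != 0 :> R.
  by apply: contra_neq n1 => n1; lra.
by field; rewrite n1 n2.
Qed.

End ln_numerics.

(** * The fractional Gaussian noise as H tends to 1 *)

Section fgn_asymptotics.
Context {R : realType}.

(** Among natural [k], the absolute value matters only at [k = 0]. *)
Definition fgn_autocov (H : R) (k : nat) : R :=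
  ((k%:R + 1) `^ (2 * H) - 2 * k%:R `^ (2 * H) + `|k%:R - 1| `^ (2 * H)) / 2.

(** Writes the autocovariance as [1 - (1 - H) * fgn_slope k H], the shape required by
    [fgn_projection_solution] with [e = 1 - H]. *)
Definition fgn_slope (k : nat) (H : R) : R := (1 - fgn_autocov H k) / (1 - H).

(** Excluding [H = 0] avoids the convention that 0 to the power 0 is 1. *)
Lemma fgn_autocov0 (H : R) : H != 0 -> fgn_autocov H 0 = 1.
Proof.
move=> H0; rewrite /fgn_autocov sub0r normrN1 add0r !powR1 powR0.
  by field.
by rewrite mulf_neq0.
Qed.

Lemma cvg_fgn_slope1 : fgn_slope 1 H @[H --> 1^'-] --> (slope1 : R).
Proof.
have s2 := @cvg_powR_slope R 2 ltac:(lra).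
apply: (@cvg_trans _ (2^-1 * ((2 ^+ 2 - 2 `^ (2 * x)) / (1 - x)) @[x --> 1^'-])).
  apply: near_eq_cvg; near=> H.
  rewrite /fgn_slope /fgn_autocov subrr normr0 powR0 ?powR1.
    rewrite (_ : 1 + 1 = 2 :> R)//; field.
    by rewrite subr_eq0 gt_eqF//; near: H; exact: nbhs_left_lt.
  by rewrite mulf_neq0// gt_eqF//; near: H; exact: nbhs_left_gt.
rewrite (_ : slope1 = 2^-1 * (2 * 2 ^+ 2 * ln 2)); last by rewrite /slope1; field.
exact: cvgMr.
Unshelve. all: by end_near. Qed.

Lemma cvg_fgn_slope2 : fgn_slope 2 H @[H --> 1^'-] --> (slope2 : R).
Proof.
have s2 := @cvg_powR_slope R 2 ltac:(lra).
have s3 := @cvg_powR_slope R 3 ltac:(lra).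
apply: (@cvg_trans _ (2^-1 * ((3 ^+ 2 - 3 `^ (2 * x)) / (1 - x))
   - (2 ^+ 2 - 2 `^ (2 * x)) / (1 - x) @[x --> 1^'-])).
  apply: near_eq_cvg; near=> H.
  rewrite /fgn_slope /fgn_autocov (_ : 2%:R - 1 = 1); last by ring.
  rewrite normr1 powR1 (_ : 2%:R + 1 = 3); last by ring.
  field.
  by rewrite subr_eq0 gt_eqF//; near: H; exact: nbhs_left_lt.
rewrite (_ : slope2 =
  2^-1 * (2 * 3 ^+ 2 * ln 3) - 2 * 2 ^+ 2 * ln 2); last first.
  by rewrite /slope2; field.
by apply: cvgB => //; exact: cvgMr.
Unshelve. all: by end_near. Qed.

Lemma cvg_fgn_slope3 : fgn_slope 3 H @[H --> 1^'-] --> (slope3 : R).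
Proof.
have s2 := @cvg_powR_slope R 2 ltac:(lra).
have s3 := @cvg_powR_slope R 3 ltac:(lra).
have s4 := @cvg_powR_slope R 4 ltac:(lra).
apply: (@cvg_trans _ (2^-1 * ((4 ^+ 2 - 4 `^ (2 * x)) / (1 - x))
   - (3 ^+ 2 - 3 `^ (2 * x)) / (1 - x)
   + 2^-1 * ((2 ^+ 2 - 2 `^ (2 * x)) / (1 - x)) @[x --> 1^'-])).
  apply: near_eq_cvg; near=> H.
  rewrite /fgn_slope /fgn_autocov (_ : 3%:R - 1 = 2); last by ring.
  rewrite ger0_norm// (_ : 3%:R + 1 = 4); last by ring.
  field.
  by rewrite subr_eq0 gt_eqF//; near: H; exact: nbhs_left_lt.
rewrite (_ : slope3 = 2^-1 * (2 * 4 ^+ 2 * ln 4) - (2 * 3 ^+ 2 * ln 3)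
  + 2^-1 * (2 * 2 ^+ 2 * ln 2)); last first.
  by have [-> _ _ _ _] := @ln_4_6_9_12_18 R; rewrite /slope3; field.
by apply: cvgD; [apply: cvgB => //|]; exact: cvgMr.
Unshelve. all: by end_near. Qed.

End fgn_asymptotics.

(** * Yule-Walker equations and passage to the limit *)

(** With truncated subtraction, [(k - l) + (l - k)] is the distance between [k] and [l], so symmetry
    reduces to the case of ordered indices. *)
Lemma increment_autocov d (T : measurableType d) (R : realType)
    (P : probability T R) (H : R) (B : R -> {RV P >-> R}) (k l : nat) :
    fractional_brownian_motion H B -> (0 < k)%N -> (0 < l)%N ->
  'E_P[increment B k * increment B l]%E =
  (fgn_autocov H ((k - l) + (l - k)))%:E.
Proof.
move=> fbmB; case: k => // i; case: l => // j _ _; rewrite !subSS.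
wlog ij : i j / (i <= j)%N.
  move=> wlg; have [/wlg//|/ltnW/wlg] := leqP i j.
  by rewrite mulrC addnC.
rewrite (increment_expectationM fbmB) /fgn_autocov.
rewrite (eqP (ij : (i - j == 0)%N)) add0n natrB//.
have ij0 : 0 <= j%:R - i%:R :> R by rewrite subr_ge0 ler_nat.
by rewrite (ger0_norm ij0) ger0_norm// addr_ge0.
Qed.

Lemma projection_yule_walker d (T : measurableType d) (R : realType)
    (P : probability T R) (H : R) (B : R -> {RV P >-> R}) n g l :
    fractional_brownian_motion H B -> projection_coefficients B n g ->
    (2 <= l <= n)%N ->
  fgn_autocov H l.-1 =
    \sum_(2 <= k < n.+1) g k * fgn_autocov H ((k - l) + (l - k)).
Proof.
move=> fbmB gE ln; have /andP[l2 _] := ln.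
have := projection_normal_equation fbmB ln gE.
rewrite (increment_autocov fbmB) ?(ltnW l2)//.
rewrite (_ : (1 - l + (l - 1) = l.-1)%N); last first.
  by case: l l2 {ln} => // l _; rewrite subn1 subSS sub0n.
rewrite [X in _ = X](_ : _ = \sum_(2 <= k < n.+1)
    (g k * fgn_autocov H ((k - l) + (l - k)))%:E)%E.
  by rewrite sumEFin => -[].
rewrite !big_nat; apply: eq_bigr => k /andP[k2 _].
by rewrite (increment_autocov fbmB) ?EFinM// ltnW.
Qed.

Theorem proposition2p14 (R : realType)
    (d : R -> measure_display) (T : forall H : R, measurableType (d H))
    (P : forall H : R, probability (T H) R)
    (B : forall H : R, R -> {RV (P H) >-> R})
    (Gamma4 : nat -> R -> R)
    (fbmB : forall H : R, 1 / 2 < H < 1 ->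
      fractional_brownian_motion H (B H))
    (Gamma4E : forall H : R, 1 / 2 < H < 1 ->
      projection_coefficients (B H) 4 (fun k => Gamma4 k H)) :
  let L2 : R :=
    (531 * ln 4 ^+ 2 + 72 * ln 6 ^+ 2 + 51 * ln 9 ^+ 2 - 384 * ln 12 ^+ 2
       + 108 * ln 18 ^+ 2)
    / (96 * ln 12 ^+ 2 - 640 * ln 2 ^+ 2 - 51 * ln 9 ^+ 2) in
  let L3 : R := (48 * ln 2 - 15 * ln 9) / (16 * ln 2 - 3 * ln 9) in
  let L4 : R :=
    (108 * ln 18 ^+ 2 - 364 * ln 2 ^+ 2 - 216 * ln 2 * ln 9 - 81 * ln 9 ^+ 2)
    / (96 * ln 12 ^+ 2 - 640 * ln 2 ^+ 2 - 51 * ln 9 ^+ 2) in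
  [/\ Gamma4 2%N H @[H --> 1^'-] --> L2 /\ rounds_to L2 742 250,
      Gamma4 3%N H @[H --> 1^'-] --> L3 /\ rounds_to L3 069 508 &
      Gamma4 4%N H @[H --> 1^'-] --> L4 /\ rounds_to L4 188 242].
Proof.
cbv zeta; rewrite -lim_half_sumE -lim_half_diffE -lim_midE.
have n2 := lt0r_neq0 (@slope2_gt0 R); have n1 := lt0r_neq0 (@slope12_gt0 R).
pose s1 := @fgn_slope R 1; pose s2 := @fgn_slope R 2; pose s3 := @fgn_slope R 3.
have cA : s1 H @[H --> 1^'-] --> (slope1 : R) := cvg_fgn_slope1.
have cB : s2 H @[H --> 1^'-] --> (slope2 : R) := cvg_fgn_slope2.
have cC : s3 H @[H --> 1^'-] --> (slope3 : R) := cvg_fgn_slope3.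
have csq (F : R -> R) (l : R) :
    F H @[H --> 1^'-] --> l -> F H ^+ 2 @[H --> 1^'-] --> l ^+ 2.
  by move=> Fl; exact: (cvgM Fl Fl).
have ce : 1 - H @[H --> 1^'-] --> (0 : R).
  rewrite -(subrr (1 : R)); apply: cvgB; first exact: cvg_cst.
  exact: cvg_at_left_filter cvg_id.
(* Disposes of the terms of higher order in [1 - H] in the explicit solution. *)
have cz (F : R -> R) (l : R) :
    F H @[H --> 1^'-] --> l -> (1 - H) * F H @[H --> 1^'-] --> (0 : R).
  by move=> cF; rewrite -(mul0r l); exact: cvgM.
pose D H := 4 * s1 H - s2 H - (1 - H) * (2 * s1 H ^+ 2).
have cD : D H @[H --> 1^'-] --> (4 * slope1 - slope2 : R).
  rewrite -[X in _ --> X]subr0; apply: cvgB.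
    by apply: cvgB => //; exact: cvgMr.
  apply: (cz _ (2 * slope1 ^+ 2)); apply: cvgMr; exact: csq.
(* [S], [M] and [Df] are the solutions for Gamma^2 + Gamma^4, Gamma^3 and Gamma^2 - Gamma^4 given by
   [fgn_projection_solution] with [e = 1 - H]. *)
pose S H := (s1 H - s3 H + 2 * s2 H - (1 - H) * (2 * s1 H * s2 H)) / D H.
pose M H := (3 * s1 H + s3 H - 3 * s2 H
  + (1 - H) * (s2 H ^+ 2 - s1 H ^+ 2 - s1 H * s3 H)) / D H.
pose Df H := (s3 H - s1 H) / s2 H.
have cS : S H @[H --> 1^'-] --> (lim_sum : R).
  apply: cvgM; last exact: cvgV.
  rewrite -[X in _ --> X]subr0; apply: cvgB.
    by apply: cvgD; [exact: cvgB|exact: cvgMr].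
  by apply: (cz _ (2 * slope1 * slope2)); apply: cvgM => //; exact: cvgMr.
have cM : M H @[H --> 1^'-] --> (lim_mid : R).
  apply: cvgM; last exact: cvgV.
  rewrite -[X in _ --> X]addr0; apply: cvgD.
    by apply: cvgB; [apply: cvgD => //|]; exact: cvgMr.
  apply: (cz _ (slope2 ^+ 2 - slope1 ^+ 2 - slope1 * slope3)).
  by apply: cvgB; [apply: cvgB; exact: csq|exact: cvgM].
have cDf : Df H @[H --> 1^'-] --> (lim_diff : R).
  by apply: cvgM; [exact: cvgB|exact: cvgV].
have sol : \forall H \near 1^'-, [/\ Gamma4 2%N H = (S H + Df H) / 2,
    Gamma4 3%N H = M H & Gamma4 4%N H = (S H - Df H) / 2].
  near=> H.
  have H1 : 1 / 2 < H < 1.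
    apply/andP; split; near: H; last exact: nbhs_left_lt.
    by apply: nbhs_left_gt; lra.
  have e0 : 1 - H != 0 by lra.
  (* Both denominators have nonzero limits, hence are nonzero for [H] close enough to 1. *)
  have B0 : s2 H != 0 by near: H; apply: cvgr_neq0 cB _ => //.
  have D0 : D H != 0 by near: H; apply: cvgr_neq0 cD _ => //.
  have YW := projection_yule_walker (fbmB _ H1) (Gamma4E _ H1).
  have slopeE k : fgn_autocov H k = 1 - (1 - H) * fgn_slope k H.
    by rewrite /fgn_slope mulrC divfK// opprB addrC subrK.
  have r0 : fgn_autocov H 0 = 1 by rewrite fgn_autocov0//; lra.
  have sum4 (F : nat -> R) : \sum_(2 <= k < 5) F k = F 2%N + F 3%N + F 4%N.
    by rewrite unlock /= addr0 addrA.
  have := YW 2%N isT; have := YW 3%N isT; have := YW 4%N isT.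
  rewrite !sum4 /= r0 !mulr1 !slopeE => E3 E2 E1.
  have D0' : 4 * s1 H - s2 H - 2 * (1 - H) * s1 H ^+ 2 != 0.
    by rewrite [2 * _]mulrC -mulrA.
  have [-> -> ->] := fgn_projection_solution e0 B0 D0' E1 E2 E3.
  rewrite /S /M /Df /D [in 2 * (1 - H)]mulrC -!mulrA.
  by split.
have ev (G F : R -> R) (l : R) : (\forall H \near 1^'-, F H = G H) ->
    F H @[H --> 1^'-] --> l -> G H @[H --> 1^'-] --> l.
  by move=> FG; apply: cvg_trans; exact: near_eq_cvg.
split; split.
- apply: ev (_ : (S H + Df H) / 2 @[H --> 1^'-] --> _).
    by apply: filterS sol => H [-> _ _].
  by apply: cvgMl; exact: cvgD.
- exact: lim_half_sum_rounds.
- by apply: ev cM; apply: filterS sol => H [_ -> _].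
- exact: lim_mid_rounds.
- apply: ev (_ : (S H - Df H) / 2 @[H --> 1^'-] --> _).
    by apply: filterS sol => H [_ _ ->].
  by apply: cvgMl; exact: cvgB.
- exact: lim_half_diff_rounds.
Unshelve. all: by end_near. Qed.
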